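(* Let $X$ be an extended metric space, let $n\ge 0$ and $\ell\in[0,\infty)$, and write $x\preceq y\preceq z$ when $d(x,y)+d(y,z)=d(x,z)$. The group $MC_{n,\ell}(X)=F_\ell C_n(X)/F_{<\ell}C_n(X)$ is free abelian on (the classes of) the nondegenerate tuples $\mathbf{x}=\langle x_0,\dots,x_n\rangle\in N(X)_n$ with $\lambda\mathbf{x}=\ell$, and the differential induced on it by the differential $\partial$ of $C_\bullet(X)$ is $$\partial=\sum_{i=1}^{n-1}(-1)^i\partial_i\colon MC_{n,\ell}(X)\longrightarrow MC_{n-1,\ell}(X),$$ where $\partial_i$ deletes the entry $x_i$ when $x_{i-1}\preceq x_i\preceq x_{i+1}$ and sends $\mathbf{x}$ to $0$ otherwise. The outer faces $d_0$ and $d_n$ vanish on the associated graded, and the differential has bidegree $(-1,0)$ with respect to (degree $n$, length $\ell$).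
   Context: An extended metric space $X$ is a set $\mathrm{Ob}\,X$ with $d\colon \mathrm{Ob}\,X\times \mathrm{Ob}\,X\to[0,\infty]$ such that $d(x,x)=0$, $d(x,y)=d(y,x)$, $d(x,z)\le d(x,y)+d(y,z)$, and $d(x,y)=0$ implies $x=y$. The length nerve $N(X)$ is the simplicial set with $N(X)_n$ the set of all maps $[n]\to\mathrm{Ob}\,X$, written $\mathbf{x}=\langle x_0,\dots,x_n\rangle$; the face $d_i$ deletes the entry $x_i$ and the degeneracy $s_i$ repeats it. The length is $\lambda\mathbf{x}=\sum_{i=1}^n d(x_{i-1},x_i)\in[0,\infty]$. The normalised chain complex $C_\bullet(X)$ has $C_n(X)=\mathbb{Z}[N(X)_n]/D_n(X)$, with $D_n(X)$ spanned by the degenerate simplices and differential $\partial=\sum_{i=0}^n(-1)^i d_i$; $C_n(X)$ is free on the nondegenerate tuples, i.e. those with $x_{i-1}\ne x_i$ for $1\le i\le n$. For $\ell\in[0,\infty)$, $F_\ell C_n(X)\subseteq C_n(X)$ is spanned by the nondegenerate tuples with $\lambda\mathbf{x}\le\ell$; these form subcomplexes increasing in $\ell$. $F_{<\ell}C_\bullet(X)=\bigcup_{\ell'<\ell}F_{\ell'}C_\bullet(X)$, which is zero for $\ell=0$. The complex $MC_{\bullet,\ell}(X)=F_\ell C_\bullet(X)/F_{<\ell}C_\bullet(X)$ is the associated graded piece at $\ell$. *)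

(* Defs.v *)
From HB Require Import structures.
From mathcomp Require Import freeg.
From mathcomp Require Import all_boot all_order all_algebra.
From mathcomp Require Import boolp classical_sets reals constructive_ereal ereal.
From mathcomp Require Import zify.

Set Implicit Arguments.
Unset Strict Implicit.
Unset Printing Implicit Defensive.

Import Order.TTheory GRing.Theory Num.Theory.

Local Open Scope classical_set_scope.
Local Open Scope ring_scope.
Local Open Scope quotient_scope.

Section AbelianGroups.

(* The subgroup of V generated by A. *)
Definition zspan (V : zmodType) (A : set V) : {pred V} :=
  [pred v | `[< forall H : {pred V}, zmod_closed H ->
                  (forall a, A a -> a \in H) -> v \in H >]].

Lemma zspan_closed (V : zmodType) (A : set V) : zmod_closed (zspan A).
Proof.
split=> [|u v /asboolP Hu /asboolP Hv]; apply/asboolP => H cH AH.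
  by case: cH.
by case: (cH) => _; apply; [exact: Hu|exact: Hv].
Qed.

HB.instance Definition _ (V : zmodType) (A : set V) :=
  GRing.isZmodClosed.Build V (zspan A) (@zspan_closed V A).

Lemma zspan_gen (V : zmodType) (A : set V) v : A v -> v \in zspan A.
Proof. by move=> Av; apply/asboolP => H _; apply. Qed.

Lemma zspan_ind (V : zmodType) (A : set V) (P : V -> Prop) :
  P 0 -> (forall u v, P u -> P v -> P (u - v)) -> (forall a, A a -> P a) ->
  forall v, v \in zspan A -> P v.
Proof.
move=> P0 PB PA v /asboolP /(_ [pred u | `[< P u >]]) Pv; apply/asboolP/Pv.
  split=> [|a b /asboolP Pa /asboolP Pb]; apply/asboolP => //.
  exact: PB.
by move=> a /PA Pa; apply/asboolP.
Qed.

Record subgroup (V : zmodType) (H : zmodClosed V) :=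
  SubGroup { sgval : V; sgvalP : sgval \in H }.

HB.instance Definition _ (V : zmodType) (H : zmodClosed V) :=
  [isSub for @sgval V H].
HB.instance Definition _ (V : zmodType) (H : zmodClosed V) :=
  [Choice of subgroup H by <:].
HB.instance Definition _ (V : zmodType) (H : zmodClosed V) :=
  [SubChoice_isSubZmodule of subgroup H by <:].

Section QuotientMap.
Variables (V W : zmodType) (I : zmodClosed V) (J : zmodClosed W).

(* The homomorphism V / I -> W / J induced by f (see quot_mapE). *)
Definition quot_map (f : {additive V -> W})
    & (forall v, v \in I -> f v \in J) :=
  fun q : Quotient.quot I => \pi_(Quotient.quot J) (f (repr q)).

Variables (f : {additive V -> W}) (fIJ : forall v, v \in I -> f v \in J).

Lemma quot_mapE v :
  quot_map fIJ (\pi_(Quotient.quot I) v) = \pi_(Quotient.quot J) (f v).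
Proof.
apply/eqP; rewrite -Quotient.idealrBE -raddfB; apply: fIJ.
by rewrite Quotient.idealrBE reprK.
Qed.

Lemma quot_map_additive : zmod_morphism (quot_map fIJ).
Proof.
move=> a b; rewrite -[a]reprK -[b]reprK -raddfB !quot_mapE.
by rewrite (raddfB f) (raddfB \pi_(Quotient.quot J)).
Qed.

HB.instance Definition _ :=
  GRing.isZmodMorphism.Build _ _ (quot_map fIJ) quot_map_additive.

End QuotientMap.
Arguments quot_map {V W I J f} fIJ q.

(* V is free abelian on the family e: the canonical map Z[B] -> V is an
   isomorphism. *)
Definition free_abelian_on (V : zmodType) (B : choiceType) (e : B -> V) :=
  bijective (fun a : {freeg B / int} => \sum_(b <- dom a) e b *~ coeff b a).

End AbelianGroups.

Record extMetric (R : realType) := ExtMetric {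
  Ob :> Type;
  dist : Ob -> Ob -> \bar R;
  dist_ge0 : forall x y, (0 <= dist x y)%E;
  dist_xx : forall x, dist x x = 0%E;
  dist_sym : forall x y, dist x y = dist y x;
  dist_triangle : forall x y z, (dist x z <= dist x y + dist y z)%E;
  dist_eq0 : forall x y, dist x y = 0%E -> x = y
}.

HB.instance Definition _ (R : realType) (X : extMetric R) := gen_eqMixin (Ob X).
HB.instance Definition _ (R : realType) (X : extMetric R) :=
  gen_choiceMixin (Ob X).

Definition between (R : realType) (X : extMetric R) (x y z : X) : bool :=
  (dist x y + dist y z == dist x z)%E.

Notation nerve X n := {ffun 'I_n.+1 -> Ob X}.

Section LengthNerve.
Variables (R : realType) (X : extMetric R).

Definition nface n (i : 'I_n.+2) (x : nerve X n.+1) : nerve X n :=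
  [ffun k => x (lift i k)].

(* unbump j k is k if k <= j and k - 1 otherwise: the entry y_j is repeated. *)
Definition ndegen n (j : 'I_n.+1) (y : nerve X n) : nerve X n.+1 :=
  [ffun k : 'I_n.+2 => y (inord (unbump j k))].

Definition degen n : nerve X n -> Prop :=
  match n with
  | 0 => fun _ => False
  | m.+1 => fun x => exists (j : 'I_m.+1) (y : nerve X m), x = ndegen j y
  end.

Definition nondegen n (x : nerve X n) : bool :=
  [forall i : 'I_n, x (widen_ord (leqnSn n) i) != x (lift ord0 i)].

Definition len n (x : nerve X n) : \bar R :=
  (\sum_(i < n) dist (x (widen_ord (leqnSn n) i)) (x (lift ord0 i)))%E.

Lemma nfaceE n (i : 'I_n.+2) (x : nerve X n.+1) k : (k <= n)%N ->
  nface i x (inord k) = x (inord (bump i k)).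
Proof.
move=> kn; rewrite ffunE; congr (x _); apply: val_inj => /=.
by rewrite !inordK // /bump; have := ltn_ord i; lia.
Qed.

Lemma degen_adj n (x : nerve X n) :
  degen x <->
  exists2 k, (k < n)%N & x (inord k) = x (inord k.+1).
Proof.
case: n x => [|n] x; first by split => //= -[].
split=> [[j [y ->]]|[k kn xk]].
  have jn := ltn_ord j.
  exists j => //; rewrite !ffunE; congr (y (inord _)).
  rewrite !inordK /unbump; lia.
exists (inord k), (nface (inord k.+1) x).
apply/ffunP => i; have iN := ltn_ord i; rewrite ffunE.
have kE : (inord k : 'I_n.+1) = k :> nat by rewrite inordK.
have kE' : (inord k.+1 : 'I_n.+2) = k.+1 :> nat by rewrite inordK.
rewrite nfaceE ?kE ?kE'; last by rewrite /unbump; lia.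
have [ik|ik] := eqVneq (i : nat) k.+1.
  have -> : i = inord k.+1 by apply: val_inj => /=; rewrite kE'.
  rewrite -xk; congr (x (inord _)); rewrite kE' /bump /unbump; lia.
rewrite -[i in LHS]inord_val; congr (x (inord _)).
by rewrite /bump /unbump; lia.
Qed.

Lemma nondegenP n (x : nerve X n) :
  nondegen x <-> ~ degen x.
Proof.
rewrite degen_adj; split=> [/forallP nd [k kn xk]|nd].
  have /eqP[] := nd (Ordinal kn).
  have -> : widen_ord (leqnSn n) (Ordinal kn) = inord k.
    by apply: val_inj; rewrite /= inordK // ltnW.
  rewrite xk; congr (x _); apply: val_inj => /=; rewrite inordK //.
apply/forallP => i; apply/eqP => xi; apply: nd; exists i => //.
move: xi; congr (x _ = x _); apply: val_inj => /=.
  by rewrite inordK // ltnW // ltnS.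
by rewrite inordK // ltnS.
Qed.

Lemma lenE n (x : nerve X n) :
  len x = (\sum_(k < n) dist (x (inord k)) (x (inord k.+1)))%E.
Proof.
apply: eq_bigr => k _; congr dist; congr (x _); apply: val_inj => /=.
  by rewrite inordK // ltnW // ltnS.
by rewrite inordK // ltnS.
Qed.

Lemma len_face n (i : 'I_n.+2) (x : nerve X n.+1) :
  (len (nface i x) <= len x)%E.
Proof.
rewrite !lenE; pose u k := x (inord k).
have -> : (\sum_(k < n) dist (nface i x (inord k)) (nface i x (inord k.+1)) =
   \sum_(k < n) dist (u (bump i k)) (u (bump i k.+1)))%E.
  by apply: eq_bigr => k _; rewrite !nfaceE // ltnW.
rewrite -/(u _).
have key m : (\sum_(k < m) dist (u (bump i k)) (u (bump i k.+1)) <=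
   \sum_(k < m + (i <= m)) dist (u k) (u k.+1))%E.
  elim: m => [|m IH]; first by rewrite big_ord0 sume_ge0 // => *; exact: dist_ge0.
  rewrite big_ord_recr /= /bump.
  have [im|mi|im] := ltngtP (i : nat) m.+1.
  - rewrite -[m.+1 in leRHS]/(m.+1) addn1 big_ord_recr /=.
    move: IH; have -> : (i <= m)%N by lia.
    by rewrite addn1 => IH; rewrite leeD.
  - rewrite addn0 big_ord_recr /=.
    move: IH; have -> : (i <= m)%N = false by lia.
    by rewrite addn0 => IH; rewrite leeD.
  - rewrite addn1 !big_ord_recr /=.
    move: IH; have -> : (i <= m)%N = false by lia.
    rewrite addn0 => IH; rewrite -addeA leeD //; exact: dist_triangle.
apply: (le_trans (key n)).
have [_|_] := leqP i n; rewrite ?addn0 ?addn1 //.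
by rewrite big_ord_recr /= leeDl // dist_ge0.
Qed.

Local Notation freeZ n := {freeg (nerve X n) / int}.

Definition degen_chains n : {pred freeZ n} :=
  zspan [set << x >> | x in @degen n].

Arguments degen_chains n : clear implicits.
HB.instance Definition _ n := GRing.ZmodClosed.on (degen_chains n).

Definition chain n := Quotient.quot (degen_chains n).
HB.instance Definition _ n := GRing.Zmodule.on (chain n).

Definition simplex n (x : nerve X n) : chain n := \pi_(Quotient.quot _) << x >>.

Definition free_boundary n : freeZ n.+1 -> freeZ n :=
  fglift (fun x => \sum_(i < n.+2) (-1) ^+ i *: << nface i x >>).
HB.instance Definition _ n :=
  GRing.isZmodMorphism.Build _ _ (@free_boundary n) (lift_is_additive _).

Lemma free_boundaryE n (x : nerve X n.+1) :
  free_boundary << x >> = \sum_(i < n.+2) (-1) ^+ i *: << nface i x >>.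
Proof. by rewrite /free_boundary liftU scale1r. Qed.

Lemma free_boundary_degen n (a : freeZ n.+1) :
  a \in degen_chains n.+1 -> free_boundary a \in degen_chains n.
Proof.
apply: (@zspan_ind _ _ (fun a => free_boundary a \in degen_chains n)).
- by rewrite raddf0 rpred0.
- by move=> u v Hu Hv; rewrite raddfB rpredB.
move=> _ [x /degen_adj[j jn xj] <-]; rewrite free_boundaryE.
pose a0 : 'I_n.+2 := inord j; pose a1 : 'I_n.+2 := inord j.+1.
have a0E : a0 = j :> nat by rewrite inordK // ltnW.
have a1E : a1 = j.+1 :> nat by rewrite inordK.
have a01 : a1 != a0 by apply/eqP => /(congr1 val) /=; rewrite a0E a1E; lia.
rewrite (bigD1 a0) //= (bigD1 a1) //= addrA.
have -> : nface a0 x = nface a1 x.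
  apply/ffunP => k; rewrite -[k]inord_val !nfaceE -1?ltnS ?ltn_ord //.
  rewrite a0E a1E /bump; have [->|kj] := eqVneq (k : nat) j.
    by rewrite leqnn ltnn add1n add0n.
  by congr (x (inord _)); lia.
rewrite a0E a1E exprS mulN1r scaleNr subrr add0r rpred_sum // => i /andP[i0 i1].
suff Hd : << nface i x >> \in degen_chains n.
  by rewrite -signr_odd; case: odd; rewrite ?expr1 ?scaleN1r ?rpredN ?scale1r.
apply: zspan_gen; exists (nface i x) => //; apply/degen_adj.
have {}i0 : (i : nat) <> j by move=> ij; case/eqP: i0; apply/val_inj; rewrite /= a0E.
have {}i1 : (i : nat) <> j.+1.
  by move=> ij; case/eqP: i1; apply/val_inj; rewrite /= a1E.
have iN := ltn_ord i.
exists (unbump i j); first by rewrite /unbump; lia.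
rewrite !nfaceE; [|by rewrite /unbump; lia|by rewrite /unbump; lia].
have -> : bump i (unbump i j) = j by rewrite /bump /unbump; lia.
by have -> : bump i (unbump i j).+1 = j.+1 by rewrite /bump /unbump; lia.
Qed.

Definition boundary n : chain n.+1 -> chain n :=
  quot_map (@free_boundary_degen n).
HB.instance Definition _ n := GRing.Additive.on (@boundary n).

Lemma boundaryE n (x : nerve X n.+1) :
  boundary (simplex x) = \sum_(i < n.+2) simplex (nface i x) *~ (-1) ^+ i.
Proof.
rewrite /boundary /simplex quot_mapE /= free_boundaryE raddf_sum /=.
apply: eq_bigr => i _; rewrite -raddfMz; congr (\pi _).
by rewrite -signr_odd; case: odd; rewrite ?expr1 ?scaleN1r ?mulrN1z ?scale1r.
Qed.

Lemma simplex_degen n (x : nerve X n) : degen x -> simplex x = 0.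
Proof.
move=> dx; apply/eqP; rewrite -(raddf0 \pi_(Quotient.quot _)) -Quotient.idealrBE.
by rewrite subr0; apply: zspan_gen; exists x.
Qed.

Definition Fchain n (l : R) : {pred chain n} :=
  zspan [set simplex x | x in [set x : nerve X n |
           nondegen x /\ (len x <= l%:E)%E]].
Arguments Fchain n l : clear implicits.
HB.instance Definition _ n l := GRing.ZmodClosed.on (Fchain n l).

(* The union over 0 <= l' < l of the groups Fchain n l', understood as the zero
   group when l = 0. *)
Definition Flt_chain n (l : R) : {pred chain n} :=
  [pred c | `[< c = 0 \/ exists2 l', 0 <= l' < l & c \in Fchain n l' >]].

Arguments Flt_chain n l : clear implicits.

Lemma Fchain_mono n (l l' : R) c : l <= l' -> c \in Fchain n l -> c \in Fchain n l'.
Proof.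
move=> ll'; apply: (@zspan_ind _ _ (fun c => c \in Fchain n l')).
- exact: rpred0.
- by move=> u v; exact: rpredB.
move=> _ [x [nx lx] <-]; apply: zspan_gen; exists x => //; split => //.
by rewrite (le_trans lx) ?lee_fin.
Qed.

Lemma Flt_chain_closed n l : zmod_closed (Flt_chain n l).
Proof.
split=> [|u v]; first by apply/asboolP; left.
move=> /asboolP[->|[a /andP[a0 al] ua]] /asboolP[->|[b /andP[b0 bl] vb]];
  apply/asboolP.
- by left; rewrite subr0.
- by right; exists b; rewrite ?b0 // sub0r rpredN.
- by right; exists a; rewrite ?a0 // subr0.
right; exists (Num.max a b); first by rewrite le_max a0 gt_max al.
by rewrite rpredB //; [apply: Fchain_mono ua|apply: Fchain_mono vb];
  rewrite le_max lexx ?orbT.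
Qed.
HB.instance Definition _ n l :=
  GRing.isZmodClosed.Build _ (Flt_chain n l) (@Flt_chain_closed n l).

Lemma simplex_F n (l : R) (x : nerve X n) :
  (len x <= l%:E)%E -> simplex x \in Fchain n l.
Proof.
move=> xl; have [nx|/negP nx] := boolP (nondegen x).
  by apply: zspan_gen; exists x.
have [dx|dx] := pselect (degen x); first by rewrite simplex_degen // rpred0.
by case: nx; apply/nondegenP.
Qed.

Lemma boundary_F n (l : R) (c : chain n.+1) :
  c \in Fchain n.+1 l -> boundary c \in Fchain n l.
Proof.
apply: (@zspan_ind _ _ (fun c => boundary c \in Fchain n l)).
- by rewrite raddf0 rpred0.
- by move=> u v Hu Hv; rewrite raddfB rpredB.
move=> _ [x [nx lx] <-]; rewrite boundaryE rpred_sum // => i _.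
by rewrite rpredMz // simplex_F // (le_trans (len_face i x)).
Qed.

Lemma boundary_Flt n (l : R) (c : chain n.+1) :
  c \in Flt_chain n.+1 l -> boundary c \in Flt_chain n l.
Proof.
move=> /asboolP[->|[l' l'l cl']]; first by rewrite raddf0 rpred0.
by apply/asboolP; right; exists l' => //; exact: boundary_F.
Qed.

Definition FC n (l : R) := subgroup (Fchain n l).
HB.instance Definition _ n l := GRing.Zmodule.on (FC n l).

Definition FltC n (l : R) : {pred FC n l} :=
  [pred c : FC n l | val c \in Flt_chain n l].

Arguments FltC n l : clear implicits.

Lemma FltC_closed n l : zmod_closed (FltC n l).
Proof.
have E c : (c \in FltC n l) = (val c \in Flt_chain n l) by [].
split=> [|u v]; rewrite !E; first by rewrite raddf0 rpred0.
by move=> uF vF; rewrite raddfB rpredB.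
Qed.
HB.instance Definition _ n l :=
  GRing.isZmodClosed.Build _ (FltC n l) (@FltC_closed n l).

Definition boundaryF n l (c : FC n.+1 l) : FC n l :=
  SubGroup (boundary_F (sgvalP c)).

Lemma boundaryF_additive n l : zmod_morphism (@boundaryF n l).
Proof. by move=> u v; apply: val_inj; rewrite /= !raddfB. Qed.
HB.instance Definition _ n l :=
  GRing.isZmodMorphism.Build _ _ (@boundaryF n l) (@boundaryF_additive n l).

Lemma boundaryF_Flt n l (c : FC n.+1 l) :
  c \in FltC n.+1 l -> boundaryF c \in FltC n l.
Proof. exact: boundary_Flt. Qed.

Definition MC n (l : R) := Quotient.quot (FltC n l).
HB.instance Definition _ n l := GRing.Zmodule.on (MC n l).

Definition MCboundary n l : MC n.+1 l -> MC n l :=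
  quot_map (@boundaryF_Flt n l).
HB.instance Definition _ n l := GRing.Additive.on (@MCboundary n l).

Lemma MCboundaryE n l (c : FC n.+1 l) :
  MCboundary (\pi_(MC n.+1 l) c) = \pi_(MC n l) (boundaryF c).
Proof. exact: quot_mapE. Qed.

(* Degenerate tuples are allowed here, so that all faces are defined. *)
Record short_simplex n (l : R) :=
  ShortSimplex { tuple_of :> nerve X n; short_len : (len tuple_of <= l%:E)%E }.

Definition short_face n l (i : 'I_n.+2) (x : short_simplex n.+1 l) :
    short_simplex n l :=
  ShortSimplex (le_trans (len_face i x) (short_len x)).

Definition MCclass n l (x : short_simplex n l) : MC n l :=
  \pi_(Quotient.quot _) (SubGroup (simplex_F (short_len x)) : FC n l).

Definition MCgen n (l : R) :=
  {x : nerve X n | nondegen x && (len x == l%:E)}.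

HB.instance Definition _ n l := Choice.on (MCgen n l).

Lemma MCgen_len n l (x : MCgen n l) : (len (val x) <= l%:E)%E.
Proof. by have /andP[_ /eqP ->] := valP x. Qed.

Definition gen_simplex n l (x : MCgen n l) : short_simplex n l :=
  ShortSimplex (MCgen_len x).

End LengthNerve.

Coercion gen_simplex : MCgen >-> short_simplex.
Arguments degen_chains {R} X n.
Arguments Fchain {R} X n l.
Arguments Flt_chain {R} X n l.
Arguments FltC {R} X n l.

(* Main.v *)
(** Sending a tuple to itself when it is nondegenerate of length [l], and to [0]
otherwise, kills degenerate tuples and tuples of length [< l], so it descends to
a coordinate map [MC n l -> Z[MCgen n l]], inverse to the canonical one.
Deleting an inner entry [y] between [x] and [z] replaces the summand
[d(x,y) + d(y,z)] of the length by [d(x,z)]; deleting an outer entry drops a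
positive summand.  So a face of a generator has length [l] exactly when the
deleted entry is inner and lies between its neighbours; otherwise the face has
length [< l] and its class vanishes. *)
Require Import Defs.
From HB Require Import structures.
From mathcomp Require Import freeg.
From mathcomp Require Import all_boot all_order all_algebra.
From mathcomp Require Import boolp classical_sets reals constructive_ereal ereal.
From mathcomp Require Import zify.

Set Implicit Arguments.
Unset Strict Implicit.
Unset Printing Implicit Defensive.

Import Order.TTheory GRing.Theory Num.Theory.

Local Open Scope ring_scope.
Local Open Scope quotient_scope.

(** * Universal properties of free abelian groups and quotients *)

HB.instance Definition _ (K : choiceType) (M : lmodType int) (f : K -> M) :=
  GRing.isZmodMorphism.Build _ _ (fglift f) (lift_is_additive f).

Section FreeAbelian.
Variables (B : choiceType) (V : zmodType) (e : B -> V).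

(** Literally the map in [free_abelian_on], named so that it can carry an additive structure. *)
Definition free_ext (a : {freeg B / int}) : V :=
  \sum_(b <- dom a) e b *~ coeff b a.

Let eZ : B -> zmodule V := e.

Lemma free_ext_lift a : free_ext a = fglift eZ a.
Proof.
rewrite -[in RHS](freeg_sumE a) (raddf_sum (fglift eZ)) /=.
by apply: eq_bigr => b _; rewrite liftU.
Qed.

Lemma free_ext_additive : zmod_morphism free_ext.
Proof.
by move=> a b; rewrite !free_ext_lift; exact: (raddfB (fglift eZ)).
Qed.
HB.instance Definition _ :=
  GRing.isZmodMorphism.Build _ _ free_ext free_ext_additive.

Lemma free_extU b : free_ext << b >> = e b.
Proof. by rewrite free_ext_lift liftU scale1r. Qed.

Lemma freeg_additive_ext (f g : {additive {freeg B / int} -> V}) :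
  (forall b, f << b >> = g << b >>) -> f =1 g.
Proof.
move=> fg a; rewrite -(freeg_sumE a) !raddf_sum; apply: eq_bigr => b _.
have -> : << coeff b a *g b >> = << b >> *~ coeff b a :> {freeg B / int}.
  by rewrite freeg_mulz -mulrzr mul1r intz.
by rewrite !raddfMz fg.
Qed.

End FreeAbelian.

Section QuotientLift.
Variables (V W : zmodType) (I : zmodClosed V) (f : {additive V -> W}).

Definition quot_lift & (forall v, v \in I -> f v = 0) :=
  fun q : Quotient.quot I => f (repr q).

Hypothesis fI : forall v, v \in I -> f v = 0.

Lemma quot_liftE v : quot_lift fI (\pi_(Quotient.quot I) v) = f v.
Proof.
apply/eqP; rewrite -subr_eq0 -raddfB fI //.
by rewrite Quotient.idealrBE reprK.
Qed.

Lemma quot_lift_additive : zmod_morphism (quot_lift fI).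
Proof.
by move=> a b; rewrite -[a]reprK -[b]reprK -raddfB !quot_liftE raddfB.
Qed.
HB.instance Definition _ :=
  GRing.isZmodMorphism.Build _ _ (quot_lift fI) quot_lift_additive.

End QuotientLift.

Lemma pi_quot_eq0 (V : zmodType) (I : zmodClosed V) v :
  v \in I -> \pi_(Quotient.quot I) v = 0.
Proof.
move=> vI; apply/eqP; rewrite -(raddf0 \pi_(Quotient.quot I)).
by rewrite -Quotient.idealrBE subr0.
Qed.

(** * Lengths and nondegeneracy of faces *)

Section LengthGraded.
Variables (R : realType) (X : extMetric R).

Lemma dist_gt0 (x y : X) : x != y -> (0 < dist x y)%E.
Proof.
move=> xy; rewrite lt_neqAle dist_ge0 andbT eq_sym.
by apply: contra_neq xy; exact: dist_eq0.
Qed.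

Lemma len_ge0 n (x : nerve X n) : (0 <= len x)%E.
Proof. by apply: sume_ge0 => i _; exact: dist_ge0. Qed.

Lemma nondegen_adj n (x : nerve X n) k :
  nondegen x -> (k < n)%N -> x (inord k) != x (inord k.+1).
Proof.
move=> /nondegenP nx kn; apply/eqP => xk; apply: nx.
by apply/degen_adj; exists k.
Qed.

Lemma len_face0 n (x : nerve X n.+1) :
  len x = (len (nface ord0 x) + dist (x (inord 0)) (x (inord 1)))%E.
Proof.
rewrite !lenE big_ord_recl addeC; congr adde.
by apply: eq_bigr => k _; rewrite !nfaceE // ltnW.
Qed.

Lemma len_face_max n (x : nerve X n.+1) :
  len x = (len (nface ord_max x) + dist (x (inord n)) (x (inord n.+1)))%E.
Proof.
rewrite !lenE big_ord_recr; congr adde.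
apply: eq_bigr => k _; have kn := ltn_ord k; rewrite !nfaceE ?(ltnW kn) //=.
by rewrite /bump; congr (dist (x (inord _)) (x (inord _))); lia.
Qed.

(** [s] collects the steps not touching [x i], which the face keeps. Distances may be infinite,
    hence a common summand instead of a difference. *)
Lemma len_face_inner n (i : 'I_n.+2) (x : nerve X n.+1) : (0 < i < n.+1)%N ->
  exists s : \bar R, [/\ (0 <= s)%E,
    len x = (s + (dist (x (inord i.-1)) (x i) + dist (x i) (x (inord i.+1))))%E
    & len (nface i x) = (s + dist (x (inord i.-1)) (x (inord i.+1)))%E].
Proof.
move=> /andP[i0 iN]; rewrite -[in x i](inord_val i); set u := fun k => x (inord k).
move: i0 iN; case Ei : (i : nat) => [//|j] _ jn /=.
(* With i = j + 1, this is the length after x_{j+2}; the index [k] is that of the face, one less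
   than in [x]. *)
pose t := (\sum_(j.+1 <= k < n) dist (u k.+1) (u k.+2))%E.
exists (\sum_(0 <= k < j) dist (u k) (u k.+1) + t)%E.
rewrite !lenE; split.
- by rewrite adde_ge0 // sume_ge0 // => k _; exact: dist_ge0.
- rewrite -(big_mkord xpredT (fun k => dist (u k) (u k.+1))).
  rewrite (@big_cat_nat _ _ _ j) //=; last by lia.
  rewrite (@big_ltn _ _ _ j) ?(@big_ltn _ _ _ j.+1) //; last by lia.
  by rewrite big_add1 /= -/t -addeA; congr adde; rewrite addeA addeC.
rewrite -(big_mkord xpredT (fun k =>
  dist (nface i x (inord k)) (nface i x (inord k.+1)))).
rewrite (@big_cat_nat _ _ _ j) //=; last by lia.
rewrite (@big_ltn _ _ _ j) // -addeA /t [X in _ = (_ + X)%E]addeC.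
congr (_ + (_ + _))%E.
- apply: eq_big_nat => k kj; rewrite !nfaceE; try lia.
  by rewrite Ei /bump; congr (dist (x (inord _)) (x (inord _))); lia.
- rewrite !nfaceE; try lia.
  by rewrite Ei /bump; congr (dist (x (inord _)) (x (inord _))); lia.
apply: eq_big_nat => k kj; rewrite !nfaceE; try lia.
by rewrite Ei /bump; congr (dist (x (inord _)) (x (inord _))); lia.
Qed.

(** The only new neighbours are x_{i-1} and x_{i+1}. If they were equal, betweenness would give
    d(x_{i-1}, x_i) + d(x_i, x_{i+1}) = 0, although x_i differs from x_{i+1}. *)
Lemma nondegen_face n (i : 'I_n.+2) (x : nerve X n.+1) : (0 < i < n.+1)%N ->
  nondegen x -> between (x (inord i.-1)) (x i) (x (inord i.+1)) ->
  nondegen (nface i x).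
Proof.
move=> iN nx bx; apply/nondegenP => /degen_adj[k kn].
rewrite !nfaceE //; last exact: ltnW.
have [ki|ki] := eqVneq k i.-1; last first.
  have -> : bump i k.+1 = (bump i k).+1 by rewrite /bump; lia.
  by apply/eqP/nondegen_adj => //; rewrite /bump; lia.
have -> : bump i k = i.-1 by rewrite /bump; lia.
have -> : bump i k.+1 = i.+1 by rewrite /bump; lia.
move=> xE; move: bx; rewrite /between xE dist_xx => /eqP d0.
suff : (0 < dist (x (inord i.+1)) (x i) + dist (x i) (x (inord i.+1)))%E.
  by rewrite d0 ltxx.
rewrite (lt_le_trans _ (leeDl _ (dist_ge0 _ _))) //.
rewrite dist_sym dist_gt0 // -[x i](congr1 x (inord_val i)).
by apply: nondegen_adj => //; case/andP: iN.
Qed.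

(** * Generators of the graded piece *)

Variable l : R.

(** Adding [s] preserves strictness because [s] is finite, being a summand of the finite total
    [l]. *)
Lemma lt_of_addeE (s a b c : \bar R) :
  (0 <= s)%E -> (0 <= b < a)%E -> c = (s + a)%E -> c = l%:E -> (s + b < l%:E)%E.
Proof.
move=> s0 /andP[b0 ba] -> E; rewrite -E.
have : (s + a)%E \is a fin_num by rewrite E.
by rewrite fin_numD => /andP[sf _]; rewrite lteD2lE.
Qed.

Lemma MCclass_lt n (x : short_simplex X n l) :
  (len x < l%:E)%E -> MCclass x = 0.
Proof.
move=> xl; apply: pi_quot_eq0; apply/asboolP; right.
have xf : len x \is a fin_num.
  by rewrite ge0_fin_numE ?len_ge0 // (lt_trans xl) ?ltry.
(* The length of [x] itself is the smaller filtration level. *)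
exists (fine (len x)); last by apply: simplex_F; rewrite fineK.
by rewrite fine_ge0 ?len_ge0 // -lte_fin fineK.
Qed.

(** Among the simplices spanning [Fchain X n l], those shorter than [l] have class 0, so the others
    generate. *)
Lemma MC_ind n (P : MC X n l -> Prop) :
  P 0 -> (forall u v, P u -> P v -> P (u - v)) ->
  (forall x : MCgen X n l, P (MCclass x)) -> forall c, P c.
Proof.
move=> P0 PB PC q; rewrite -[q]reprK; case: (repr q) => c cF.
pose cl a (aF : a \in Fchain X n l) :=
  \pi_(MC X n l) (Defs.SubGroup aF : FC X n l).
have clE a aF a' aF' : a = a' -> cl a aF = cl a' aF'.
  by move=> aa'; congr (\pi _); apply: val_inj.
(* [zspan_ind] inducts on ambient chains, so the membership proof is quantified inside the
   predicate; [clE] makes its choice irrelevant. *)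
suff [cF' Pc] : exists aF : c \in Fchain X n l, P (cl c aF).
  by rewrite -/(cl c cF) (clE _ _ c cF').
move: c cF.
apply: (@zspan_ind _ _ (fun a => exists aF : a \in Fchain X n l, P (cl a aF))).
- exists (rpred0 _); have -> // : cl 0 (rpred0 _) = 0.
  by apply: pi_quot_eq0; exact: (rpred0 (Flt_chain X n l)).
- move=> u v [uF Pu] [vF Pv]; exists (rpredB uF vF).
  suff -> : cl (u - v) (rpredB uF vF) = cl u uF - cl v vF by exact: PB.
  by rewrite /cl -raddfB; congr (\pi _); apply: val_inj.
move=> _ [x [nx xl] <-]; exists (simplex_F xl).
change (P (MCclass (ShortSimplex xl))).
have [xl'|xl'] := eqVneq (len x) l%:E; last first.
  by rewrite MCclass_lt // lt_neqAle xl' xl.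
have xP : nondegen x && (len x == l%:E) by rewrite nx xl' eqxx.
suff -> : MCclass (ShortSimplex xl) = MCclass (Sub x xP : MCgen X n l).
  exact: PC.
by congr (\pi _); apply: val_inj.
Qed.

(** * Coordinates and freeness *)

Section Coordinates.
Variable n : nat.

(** Defined on all tuples, longer ones included, so that it extends to the whole of [chain X n]
    before restriction along [val]. *)
Definition gen_coord (x : nerve X n) : {freeg (MCgen X n l) / int} :=
  if insub x is Some y then << (y : MCgen X n l) >> else 0.

Lemma free_coord_degen a :
  a \in degen_chains X n -> free_ext gen_coord a = 0.
Proof.
apply: (@zspan_ind _ _ (fun a => free_ext gen_coord a = 0)).
- exact: raddf0.
- by move=> u v u0 v0; rewrite raddfB /= u0 v0 subr0.
move=> _ [x dx <-]; rewrite free_extU /gen_coord insubN //.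
by apply/negP => /andP[/nondegenP].
Qed.

Definition chain_coord : chain X n -> {freeg (MCgen X n l) / int} :=
  quot_lift free_coord_degen.
HB.instance Definition _ := GRing.Additive.on chain_coord.

Lemma chain_coordE x : chain_coord (simplex x) = gen_coord x.
Proof. by rewrite /chain_coord /simplex quot_liftE /= free_extU. Qed.

(** A nonzero such chain lies in some [Fchain X n l'] with l' < l, whose spanning tuples are too
    short to be generators. *)
Lemma chain_coord_Flt (c : FC X n l) :
  c \in FltC X n l -> (chain_coord \o val) c = 0.
Proof.
case: c => c cF /asboolP /= [-> |[l' /andP[_ l'l]]]; first exact: raddf0.
move: c {cF}; apply: (@zspan_ind _ _ (fun c => chain_coord c = 0)).
- exact: raddf0.
- by move=> u v u0 v0; rewrite raddfB /= u0 v0 subr0.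
move=> _ [x [_ xl] <-]; rewrite chain_coordE /gen_coord insubN //.
by apply/negP => /andP[_ /eqP xl']; move: xl; rewrite xl' lee_fin leNgt l'l.
Qed.

Definition MCcoord : MC X n l -> {freeg (MCgen X n l) / int} :=
  quot_lift chain_coord_Flt.
HB.instance Definition _ := GRing.Additive.on MCcoord.

Lemma MCcoordE (x : MCgen X n l) : MCcoord (MCclass x) = << x >>.
Proof.
by rewrite /MCcoord /MCclass quot_liftE /= chain_coordE /gen_coord valK.
Qed.

Lemma MC_free : free_abelian_on (fun x : MCgen X n l => MCclass x).
Proof.
exists MCcoord.
  pose cls := free_ext (fun x : MCgen X n l => MCclass x).
  apply: (@freeg_additive_ext _ _ (MCcoord \o cls) idfun).
  by move=> x /=; rewrite /cls free_extU MCcoordE.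
apply: MC_ind => [|u v Hu Hv|x].
- by rewrite -/(free_ext _ _) !raddf0.
- rewrite -/(free_ext (fun x : MCgen X n l => MCclass x) _) !raddfB.
  by congr (_ - _).
by rewrite -/(free_ext _ _) MCcoordE free_extU.
Qed.

End Coordinates.

(** * Faces and boundary of a generator *)

Section Faces.
Variables (n : nat) (x : MCgen X n.+1 l).

Let nx : nondegen (val x). Proof. by case/andP: (valP x). Qed.
Let lx : len (val x) = l%:E. Proof. by case/andP: (valP x) => _ /eqP. Qed.

Lemma MCclass_outer :
  MCclass (short_face ord0 x) = 0 /\ MCclass (short_face ord_max x) = 0.
Proof.
(* With s the length of the face, compare s + 0 with s + d, where d > 0 is the dropped summand. *)
split; apply: MCclass_lt; rewrite -[len _]adde0.
  apply: (lt_of_addeE (len_ge0 _) _ (len_face0 _) lx).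
  by rewrite lexx dist_gt0 // nondegen_adj.
apply: (lt_of_addeE (len_ge0 _) _ (len_face_max _) lx).
by rewrite lexx dist_gt0 // nondegen_adj.
Qed.

Lemma MCclass_inner (i : 'I_n.+2) : (0 < i < n.+1)%N ->
  ~~ between (x (inord i.-1)) (x i) (x (inord i.+1)) ->
  MCclass (short_face i x) = 0.
Proof.
move=> iN nb; apply: MCclass_lt.
have [s [s0 lxE lfE]] := len_face_inner (val x) iN.
rewrite [len _]lfE; apply: (lt_of_addeE s0 _ lxE lx).
by rewrite dist_ge0 lt_neqAle eq_sym nb dist_triangle.
Qed.

(** The quotient map and [val] are additive, so this descends from [boundaryE]; outer faces are
    still present. *)
Lemma MCboundary_gen :
  MCboundary (MCclass x) =
  \sum_(i < n.+2) MCclass (short_face i x) *~ (-1) ^+ i.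
Proof.
rewrite /MCclass MCboundaryE.
under eq_bigr do rewrite -raddfMz.
rewrite -raddf_sum; congr (\pi _); apply: val_inj.
rewrite (raddf_sum val); apply: etrans (boundaryE _) _; apply: eq_bigr => i _.
by rewrite raddfMz.
Qed.

End Faces.
End LengthGraded.

Theorem proposition4p4 (R : realType) (X : extMetric R) (n : nat) (l : R)
    (l_ge0 : 0 <= l) :
  [/\ free_abelian_on (fun x : MCgen X n l => MCclass x),
      exists del : 'I_n.+2 -> {additive MC X n.+1 l -> MC X n l},
        (forall (i : 'I_n.+2) (x : MCgen X n.+1 l), (0 < i < n.+1)%N ->
           del i (MCclass x) =
           if between (x (inord i.-1)) (x i) (x (inord i.+1))
           then MCclass (short_face i x) else 0) /\
        (forall c : MC X n.+1 l,
           MCboundary c = \sum_(i < n.+2 | (0 < i < n.+1)%N)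
                            del i c *~ (-1) ^+ i),
      forall x : MCgen X n.+1 l,
        MCclass (short_face ord0 x) = 0 /\ MCclass (short_face ord_max x) = 0
    & forall (i : 'I_n.+2) (x : MCgen X n.+1 l), (0 < i < n.+1)%N ->
        between (x (inord i.-1)) (x i) (x (inord i.+1)) ->
        nondegen (nface i x) /\ len (nface i x) = l%:E ].
Proof.
split; [exact: MC_free| |exact: MCclass_outer|].
  (* By freeness [del i] may be prescribed on generators. No betweenness test is built in: for inner
     i the class is already 0 when the test fails. *)
  pose del (i : 'I_n.+2) : {additive MC X n.+1 l -> MC X n l} :=
    free_ext (fun x : MCgen X n.+1 l => MCclass (short_face i x))
    \o @MCcoord R X l n.+1.
  have delE i (x : MCgen X n.+1 l) : del i (MCclass x) = MCclass (short_face i x).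
    by rewrite /del /= MCcoordE free_extU.
  exists del; split=> [i x iN|].
    by rewrite delE; case: ifPn => // /(MCclass_inner iN).
  apply: MC_ind => [|u v Hu Hv|x].
  - by rewrite raddf0 big1 // => i _; rewrite raddf0 mul0rz.
  - rewrite raddfB [X in X - _]Hu [X in _ - X]Hv -sumrB; apply: eq_bigr => i _.
    by rewrite raddfB mulrzBl.
  (* [big_mkcond] puts zeros at i = 0 and i = n + 1, matching the vanishing outer faces. *)
  rewrite MCboundary_gen [RHS]big_mkcond; apply: eq_bigr => i _.
  rewrite delE; case: ifPn => // iN.
  have [x0 xmax] := MCclass_outer x.
  suff [->|->] : i = ord0 \/ i = ord_max by rewrite ?x0 ?xmax mul0rz.
  have [i0|i0] := posnP i; [left|right]; apply: val_inj => //=.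
  by have := ltn_ord i; lia.
move=> i x iN bx; have /andP[nx /eqP lx] := valP x.
split; first exact: nondegen_face.
(* Both lengths share [s]; betweenness equates the remaining terms. *)
have [s [_ lxE lfE]] := len_face_inner (val x) iN.
by apply: etrans lx; rewrite lfE lxE; congr adde; apply/esym/eqP.
Qed.
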